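(* Let $G$ be a $\{P_5,K_4,\mathrm{Kite},\mathrm{Bull}\}$-free graph which contains an induced $C_5$. Then $G$ is $k$-indicated colorable for all $k\geq\chi(G)$.
   Context: All graphs are finite, simple and undirected. $P_n$, $C_n$, $K_n$ denote the path, cycle and complete graph on $n$ vertices; $\chi(G)$ is the chromatic number. A graph is $\mathcal{F}$-free if it has no induced subgraph isomorphic to a member of $\mathcal{F}$. The Kite is the 5-vertex graph obtained from $K_4$ minus an edge by attaching a pendant vertex to one of its two vertices of degree 2. The Bull is the 5-vertex graph obtained from a triangle by attaching one pendant vertex to each of two distinct vertices of the triangle. Indicated coloring game on $G$ with a fixed set of $k$ colors: in each round Ann selects an uncolored vertex, and then Ben assigns it one of the $k$ colors not already used on its neighbors (so that the partial coloring stays proper). Ann wins if the whole graph gets properly colored; Ben wins if at some stage there is an uncolored vertex all $k$ colors of which appear on its neighbors. $G$ is $k$-indicated colorable if Ann has a winning strategy (regardless of how Ben plays) with $k$ colors. *)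

(* Defs.v *)
From Stdlib Require List.
From mathcomp Require Import all_boot.

Set Implicit Arguments.
Unset Strict Implicit.
Unset Printing Implicit Defensive.

Record sgraph := SGraph {
  vertex :> finType;
  edge : rel vertex;
  edge_sym : symmetric edge;
  edge_irrefl : irreflexive edge }.

Arguments edge {s} x y.

Section NatGraph.
Variables (n : nat) (r : rel nat).

Definition nat_edge : rel 'I_n :=
  fun i j => (i != j) && (r i j || r j i).

Lemma nat_edge_sym : symmetric nat_edge.
Proof. by move=> i j; rewrite /nat_edge eq_sym orbC. Qed.

Lemma nat_edge_irrefl : irreflexive nat_edge.
Proof. by move=> i; rewrite /nat_edge eqxx. Qed.

(* The graph on 0, ..., n-1 whose edges are the pairs of distinct vertices
   related by r in one of the two orders. *)
Definition nat_graph := SGraph nat_edge_sym nat_edge_irrefl.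

End NatGraph.

Definition path_graph n := nat_graph n (fun i j => j == i.+1).
(* This is the cycle C_n only for n >= 3. *)
Definition cycle_graph n := nat_graph n (fun i j => j == i.+1 %% n).
Definition complete_graph n := nat_graph n (fun _ _ => true).

(* K_4 minus the edge {0, 3}, with the pendant vertex 4 attached to 3. *)
Definition kite := nat_graph 5 (fun i j =>
  (i, j) \in [:: (0, 1); (0, 2); (1, 2); (1, 3); (2, 3); (3, 4)]).

(* The triangle {0, 1, 2}, with pendant vertices 3 and 4 attached to 0 and 1. *)
Definition bull := nat_graph 5 (fun i j =>
  (i, j) \in [:: (0, 1); (0, 2); (1, 2); (0, 3); (1, 4)]).

Definition contains_induced (G H : sgraph) : Prop :=
  exists f : H -> G,
    injective f /\ forall x y : H, edge (f x) (f y) = edge x y.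

Definition free (F : seq sgraph) (G : sgraph) : Prop :=
  forall H : sgraph, List.In H F -> ~ contains_induced G H.

Definition colorable (G : sgraph) (k : nat) : bool :=
  [exists f : {ffun G -> 'I_k},
    [forall x, forall y, edge x y ==> (f x != f y)]].

Lemma ex_colorable (G : sgraph) : exists k, colorable G k.
Proof.
exists #|G|; apply/existsP; exists [ffun x => enum_rank x].
apply/forallP=> x; apply/forallP=> y; apply/implyP=> xy.
rewrite !ffunE (inj_eq enum_rank_inj); apply: contraTneq xy => ->.
by rewrite edge_irrefl.
Qed.

Definition chi (G : sgraph) : nat := ex_minn (ex_colorable G).

Section IndicatedColoring.
Variables (G : sgraph) (k : nat).

(* A partial colouring of G; None marks an uncoloured vertex. *)
Definition position := {ffun G -> option 'I_k}.

Definition start : position := [ffun => None].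

Definition complete (c : position) : Prop := forall v, c v <> None.

Definition available (c : position) (v : G) (a : 'I_k) : Prop :=
  forall w, edge v w -> c w <> Some a.

Definition assign (c : position) (v : G) (a : 'I_k) : position :=
  [ffun w => if w == v then Some a else c w].

Definition ben_wins (c : position) : Prop :=
  exists v, c v = None /\ forall a, exists w, edge v w /\ c w = Some a.

(* The vertex that Ann selects at each position; None means no selection. *)
Definition strategy := position -> option G.

(* The positions that can occur when Ann follows s and Ben plays any
   available colours. *)
Inductive reachable (s : strategy) : position -> Prop :=
| reach_start : reachable s start
| reach_round c v a :
    reachable s c -> s c = Some v -> c v = None -> available c v a ->
    reachable s (assign c v a).

(* A play has at most #|G| rounds, so Ann wins every play as soon as Ben never
   wins and she always selects an uncoloured vertex while there is one. *)
Definition winning (s : strategy) : Prop :=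
  forall c, reachable s c ->
    ~ ben_wins c /\
    (~ complete c -> exists v, s c = Some v /\ c v = None).

Definition indicated_colorable : Prop := exists s : strategy, winning s.

End IndicatedColoring.

(* Main.v *)
Require Import Defs.
From mathcomp Require Import all_boot.
From Stdlib Require Import Classical_Prop.

Set Implicit Arguments.
Unset Strict Implicit.
Unset Printing Implicit Defensive.

(* By induction on |S|, Ann can get every vertex set S coloured, for k >= 3 and
   k >= chi(G). If some x in S has fewer than k neighbours in S, or has its
   neighbourhood in S contained in that of another y in S, she leaves x to the
   end: in the second case the colour of y is available for x. Otherwise every
   x in S has at least k neighbours in S, and any distinct x, y in S admit a
   neighbour of x in S that is not one of y. These facts keep producing new
   vertices, and the finite tree of configurations obtained from any single
   vertex closes up: S contains an induced 5-wheel, triangular prism or C_7^2.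
   - A 5-wheel forces k >= 4; with minimum degree 4 its tree closes up too.
   - Without a 5-wheel, a prism or a C_7^2 has no further neighbour in S. Its
     degree, 3 or 4, is then equal to k. Ann first plays k + 1 of its vertices;
     two of them, u and v, get the same colour, and of the two vertices left she
     plays a common neighbour of u and v last, which is thus colourable. *)

(* A graph on 0, ..., n-1 is encoded by a sequence of n rows; row j lists the
   adjacencies of j to 0, ..., j-1. *)
Definition adj (M : seq bitseq) : rel nat := fun i j =>
  if i < j then nth false (nth [::] M j) i
  else if j < i then nth false (nth [::] M i) j else false.

Definition code (n : nat) (a : rel nat) : seq bitseq :=
  [seq [seq a i j | i <- iota 0 j] | j <- iota 0 n].

Lemma adj_sym M : symmetric (adj M).
Proof. by move=> i j; rewrite /adj; case: ltngtP. Qed.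

Lemma adj_irrefl M : irreflexive (adj M).
Proof. by move=> i; rewrite /adj ltnn. Qed.

Lemma size_code n a : size (code n a) = n.
Proof. by rewrite size_map size_iota. Qed.

Lemma adj_code n a i j : symmetric a -> irreflexive a -> i < n -> j < n ->
  adj (code n a) i j = a i j.
Proof.
move=> asym airr lin ljn.
have E x y : x < y -> y < n -> nth false (nth [::] (code n a) y) x = a x y.
  move=> xy yn; rewrite (nth_map 0) ?size_iota // nth_iota // add0n.
  by rewrite (nth_map 0) ?size_iota // nth_iota.
rewrite /adj; case: ltngtP => ij; first exact: E.
  by rewrite E // asym.
by rewrite ij airr.
Qed.

Lemma adj_rcons_old M r i j : i < size M -> j < size M ->
  adj (rcons M r) i j = adj M i j.
Proof. by move=> iM jM; rewrite /adj !nth_rcons iM jM. Qed.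

Lemma adj_rcons_last M r i : i < size M ->
  adj (rcons M r) i (size M) = nth false r i.
Proof. by move=> iM; rewrite /adj iM nth_rcons ltnn eqxx. Qed.

Lemma adj_take k M i j : i < k -> j < k -> adj (take k M) i j = adj M i j.
Proof. by move=> ik jk; rewrite /adj !nth_take. Qed.

(* Unlike [all] and [has], these short-circuit under call by value. *)
Fixpoint every (P : pred nat) n :=
  if n is n'.+1 then if P n' then every P n' else false else true.

Fixpoint some (P : pred nat) n :=
  if n is n'.+1 then if P n' then true else some P n' else false.

Lemma everyP (P : pred nat) n :
  reflect (forall i, i < n -> P i) (every P n).
Proof.
elim: n => [|n IHn] /=; first by left.
case Pn: (P n); last by right=> /(_ n (ltnSn n)); rewrite Pn.
apply: (iffP IHn) => [H i | H i lin]; last exact/H/ltnW.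
by rewrite ltnS leq_eqVlt => /predU1P[-> | /H].
Qed.

Lemma someP (P : pred nat) n : reflect (exists2 i, i < n & P i) (some P n).
Proof.
elim: n => [|n IHn] /=; first by right=> [[]].
case Pn: (P n); first by left; exists n.
apply: (iffP IHn) => -[i lin Pi]; exists i => //; first exact: ltnW.
by move: lin; rewrite ltnS leq_eqVlt => /predU1P[E|//]; rewrite -E Pi in Pn.
Qed.

(** * Search through growing configurations *)

Section Search.
Variables (F T : seq (seq bitseq)) (d : nat).

(* Extends the embedding p of the first k vertices of H by r more vertices. *)
Fixpoint embeds (M H : seq bitseq) r k (p : nat -> nat) : bool :=
  if r is r'.+1 then
    some (fun j =>
      if every (fun i => if p i == j then false
                         else adj M (p i) j == adj H i k) k
      then embeds M H r' k.+1 (fun i => if i == k then j else p i)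
      else false) (size M)
  else true.

(** Configurations grow by one vertex at a time, so a pattern that newly appears contains the newest
    vertex. *)
Definition embeds_last M H := embeds M H (size H).-1 1 (fun=> (size M).-1).

Fixpoint avoids (Hs : seq (seq bitseq)) (M : seq bitseq) :=
  if Hs is H :: Hs' then if embeds_last M H then false else avoids Hs' M
  else true.

(* The rows by which M may be extended are grown bit by bit: the first n bits
   must already be consistent with the first n vertices. *)
Fixpoint prefix_rows M n : seq bitseq :=
  if n is n'.+1 then
    [seq r <- [seq rcons r b | r <- prefix_rows M n', b <- [:: true; false]]
       | avoids F (rcons (take n M) r)]
  else [:: [::]].

Definition rows M :=
  [seq r <- prefix_rows M (size M) | avoids T (rcons M r)].

(* Each element of [moves M (rows M)] lists all the possible rows of a vertex
   that must exist, because a vertex of M lacks neighbours or because a vertex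
   of M is dominated by another one. *)
Definition moves (M : seq bitseq) (R : seq bitseq) : seq (seq bitseq) :=
  let n := size M in
  [seq [seq r <- R | nth false r i]
     | i <- iota 0 n & count (adj M i) (iota 0 n) < d] ++
  [seq [seq r <- R | nth false r i && ~~ nth false r j]
     | i <- iota 0 n, j <- [seq j <- iota 0 n |
         (i != j) && every (fun l => adj M i l ==> adj M j l) n]].

(** Branching on any element of [moves] is sound; the one with the fewest rows keeps the tree
    small. *)
Definition shortest (m : seq bitseq) ms :=
  foldl (fun b l => if size l < size b then l else b) m ms.

(** A branch closes when the chosen list is empty: a vertex that must exist has no possible row.
    Running out of fuel or of moves gives [false], which proves nothing. *)
Fixpoint refute fuel M :=
  if fuel is fuel'.+1 then
    if moves M (rows M) is m :: ms then
      all (fun r => refute fuel' (rcons M r)) (shortest m ms)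
    else false
  else false.

(** [has id r] selects the rows of vertices with a neighbour in [M]. When all are refuted, [M] is a
    union of components of the graph induced on S. *)
Definition isolates fuel M :=
  all (fun r => refute fuel (rcons M r)) [seq r <- rows M | has id r].

Lemma mem_shortest m ms : shortest m ms \in m :: ms.
Proof.
rewrite /shortest; elim: ms m => [|l ms IH] m /=; first exact: mem_head.
have := IH (if size l < size m then l else m).
by rewrite !inE; case: ifP => _ /orP[/eqP->|->]; rewrite ?eqxx ?orbT.
Qed.

End Search.

(** * Soundness of the search inside a vertex set *)

Definition nbrs (G : sgraph) (S : {set G}) (x : G) := [set y in S | edge x y].

Section Realization.
Variables (G : sgraph) (S : {set G}).

Definition realizes (M : seq bitseq) (s : nat -> G) :=
  [/\ forall i, i < size M -> s i \in S,
      forall i j, i < size M -> j < size M -> s i = s j -> i = j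
    & forall i j, i < size M -> j < size M -> edge (s i) (s j) = adj M i j].

Definition occurs M := exists s, realizes M s.

Lemma realizes_take k M s : realizes M s -> realizes (take k M) s.
Proof.
case=> sS sinj sadj.
have le i : i < size (take k M) -> i < k /\ i < size M.
  rewrite size_take; case: ifP => h lt; split => //; first exact: ltn_trans h.
  by apply: leq_trans lt _; rewrite leqNgt h.
split=> [i /le[_ /sS] // | i j /le[_ iM] /le[_ jM] | i j /le[ik iM] /le[jk jM]].
  exact: sinj.
by rewrite adj_take // sadj.
Qed.

Lemma realizes_rcons M s z : realizes M s -> z \in S ->
    (forall i, i < size M -> s i != z) ->
  realizes (rcons M (mkseq (fun i => edge z (s i)) (size M)))
           (fun i => if i == size M then z else s i).
Proof.
case=> sS sinj sadj zS znew; set n := size M.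
have new i : i < size (rcons M (mkseq (fun i => edge z (s i)) n)) ->
    (i == n) || (i < n) by rewrite size_rcons ltnS leq_eqVlt.
split=> [i /new | i j /new iM /new jM | i j /new iM /new jM].
- by case: eqP => //= _; apply: sS.
- move: iM jM.
  case: (eqVneq i n) => [->|_] /=; case: (eqVneq j n) => [->|_] //= iM jM.
  + by move=> E; have := znew _ jM; rewrite -E eqxx.
  + by move=> E; have := znew _ iM; rewrite E eqxx.
  exact: sinj.
move: iM jM.
case: (eqVneq i n) => [->|_] /=; case: (eqVneq j n) => [->|_] //= iM jM.
- by rewrite edge_irrefl adj_irrefl.
- by rewrite adj_sym adj_rcons_last // nth_mkseq.
- by rewrite adj_rcons_last // nth_mkseq // edge_sym.
by rewrite adj_rcons_old // sadj.
Qed.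

Lemma embeds_occurs M H s r k p : realizes M s -> size H <= r + k ->
    (forall i, i < k -> p i < size M) ->
    (forall i j, i < j -> j < k ->
       p i != p j /\ adj M (p i) (p j) = adj H i j) ->
  embeds M H r k p -> occurs H.
Proof.
move=> [sS sinj sadj]; elim: r k p => [|r IHr] k p /= szH pM padj.
  move=> _; exists (s \o p).
  have lek i : i < size H -> i < k by move=> /leq_trans; apply.
  split=> [i /lek/pM/sS // | i j /lek ik /lek jk | i j /lek ik /lek jk] /=.
    move/sinj=> /(_ (pM _ ik) (pM _ jk)).
    by case: (ltngtP i j) => // ij /eqP; [case: (padj i j) | case: (padj j i)];
      rewrite // eq_sym => /negbTE->.
  rewrite sadj ?pM //; case: (ltngtP i j) => [ij|ji|->].
  - by case: (padj i j).
  - by rewrite adj_sym (adj_sym H); case: (padj j i).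
  by rewrite !adj_irrefl.
case/someP=> j jM; case: everyP => // Hj.
apply: IHr => [|i|i l il]; first by rewrite addnS.
  by rewrite ltnS leq_eqVlt; case: eqP => //= _; apply: pM.
rewrite ltnS leq_eqVlt; case: (eqVneq l k) => [E|_] /= lk; last first.
  by rewrite (ltn_eqF (ltn_trans il lk)); apply: padj.
have ik : i < k by rewrite -E.
rewrite E (ltn_eqF ik).
by have := Hj _ ik; case: ifP => // /negbT ? /eqP.
Qed.

Lemma realizes_avoids Hs M s : realizes M s -> 0 < size M ->
  (forall H, H \in Hs -> ~ occurs H) -> avoids Hs M.
Proof.
move=> Ms M0; elim: Hs => //= H Hs IH noH.
case: ifP => [E|_]; last first.
  by apply: IH => H' H'in; apply: noH; rewrite inE H'in orbT.
case: (noH H); first exact: mem_head.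
apply: (embeds_occurs Ms _ _ _ E) => [|i _|i j].
- by rewrite addn1; case: (size H).
- by rewrite prednK.
by move=> ij; rewrite ltnS leqn0 => /eqP j0; rewrite j0 in ij.
Qed.

Section Soundness.
Variables (F T : seq (seq bitseq)) (d : nat).
Hypothesis noF : forall H, H \in F -> ~ occurs H.
Hypothesis noT : forall H, H \in T -> ~ occurs H.
Hypothesis degS : forall x, x \in S -> d <= #|nbrs S x|.
Hypothesis nondom : forall x y, x \in S -> y \in S -> x != y ->
  ~~ (nbrs S x \subset nbrs S y).

Lemma mem_rows M s z : realizes M s -> z \in S ->
    (forall i, i < size M -> s i != z) ->
  mkseq (fun i => edge z (s i)) (size M) \in rows F T M.
Proof.
move=> Ms zS znew; rewrite mem_filter; apply/andP; split.
  by apply: realizes_avoids noT; [exact: realizes_rcons | rewrite size_rcons].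
have H k : k <= size M ->
    mkseq (fun i => edge z (s i)) k \in prefix_rows F M k.
  elim: k => [|k IHk] kM; first by rewrite inE.
  rewrite [prefix_rows _ _ _]/= mem_filter; apply/andP; split.
    have szk : size (take k.+1 M) = k.+1 by rewrite size_takel.
    apply: realizes_avoids noF; last by rewrite size_rcons.
    have := realizes_rcons (realizes_take k.+1 Ms) zS.
    by rewrite szk; apply=> i ik; apply/znew/(leq_trans ik).
  apply/flatten_mapP; exists (mkseq (fun i => edge z (s i)) k).
    exact/IHk/ltnW.
  by rewrite mkseqS !inE; case: edge; rewrite eqxx ?orbT.
exact: H.
Qed.

(** A vertex with fewer than [d] neighbours in [M] has another one outside, by [degS]. If j
    dominates i within [M], then [nondom] yields a neighbour of [s i] that [s j] misses; it is not
    in [M], where every neighbour of i is one of j. *)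
Lemma moves_sound M s L : realizes M s -> L \in moves d M (rows F T M) ->
  exists z, [/\ z \in S, forall i, i < size M -> s i != z
              & mkseq (fun i => edge z (s i)) (size M) \in L].
Proof.
move=> Ms; case: (Ms) => sS sinj sadj; rewrite mem_cat => /orP[].
  case/mapP=> i; rewrite mem_filter mem_iota add0n => /andP[ltd iM] ->.
  have /subsetPn[z] : ~~ (nbrs S (s i) \subset
      [seq s j | j <- [seq j <- iota 0 (size M) | adj M i j]]).
    apply: contraTN ltd => /subset_leq_card le; rewrite -leqNgt.
    apply: leq_trans (degS (sS _ iM)) _; apply: leq_trans le _.
    by apply: leq_trans (card_size _) _; rewrite size_map size_filter.
  rewrite inE => /andP[zS ziE] zout.
  have znew j : j < size M -> s j != z.
    move=> jM; apply: contraNneq zout => E; apply/mapP; exists j => //.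
    by rewrite mem_filter mem_iota jM -sadj // E ziE.
  exists z; split=> //; rewrite mem_filter mem_rows // andbT nth_mkseq //.
  by rewrite edge_sym.
case/allpairsPdep=> i [j [iM jM ->]]; move: iM jM.
rewrite mem_filter !mem_iota !add0n /= => iM /andP[/andP[ij /everyP sub] jM].
have sij : s i != s j by apply: contraNneq ij => /sinj->.
have /subsetPn[z] := nondom (sS _ iM) (sS _ jM) sij.
rewrite !inE => /andP[zS iz]; rewrite zS /= => jz.
exists z; split=> //.
  move=> l lM; apply: contraNneq jz => E; rewrite -E sadj //.
  by move: (sub _ lM); rewrite -sadj // E iz.
rewrite mem_filter mem_rows //.
  by rewrite andbT !nth_mkseq // !(edge_sym z) iz.
move=> l lM; apply: contraNneq jz => E; rewrite -E sadj //.
by move: (sub _ lM); rewrite -sadj // E iz.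
Qed.

Lemma refute_sound fuel M s : realizes M s -> ~~ refute F T d fuel M.
Proof.
elim: fuel M s => //= fuel IH M s Ms.
case E: (moves d M _) => [//|m ms].
have := mem_shortest m ms; rewrite -E => /(moves_sound Ms)[z [zS znew zL]].
apply/negP=> /allP/(_ _ zL); apply/negP.
exact: IH (realizes_rcons Ms zS znew).
Qed.

Lemma isolates_sound fuel M s i z : realizes M s -> isolates F T d fuel M ->
  i < size M -> z \in S -> edge (s i) z -> exists2 j, j < size M & z = s j.
Proof.
move=> Ms /allP iso iM zS iz.
have [/someP[j jM /eqP->]|none] := boolP (some (fun j => z == s j) (size M)).
  by exists j.
have znew j : j < size M -> s j != z.
  by move=> jM; apply: contraNneq none => <-; apply/someP; exists j.
have /negP[] := refute_sound fuel (realizes_rcons Ms zS znew).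
apply: iso; rewrite mem_filter mem_rows // andbT.
apply/hasP; exists true => //; apply/mapP; exists i.
  by rewrite mem_iota.
by rewrite edge_sym iz.
Qed.

End Soundness.
End Realization.

(** * Labelled patterns and induced subgraphs *)

Definition nat_adj (r : rel nat) : rel nat :=
  fun i j => (i != j) && (r i j || r j i).

Lemma nat_adj_sym r : symmetric (nat_adj r).
Proof. by move=> i j; rewrite /nat_adj eq_sym orbC. Qed.

Lemma nat_adj_irrefl r : irreflexive (nat_adj r).
Proof. by move=> i; rewrite /nat_adj eqxx. Qed.

Definition relabel n (r : rel nat) (o : seq nat) :=
  code n (fun i j => nat_adj r (nth 0 o i) (nth 0 o j)).

Lemma adj_relabel n r o i j : i < n -> j < n ->
  adj (relabel n r o) i j = nat_adj r (nth 0 o i) (nth 0 o j).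
Proof.
by apply: adj_code => [x y|x]; [apply: nat_adj_sym | apply: nat_adj_irrefl].
Qed.

Definition views n r os := [seq relabel n r o | o <- os].

Section Occurrence.
Variables (G : sgraph) (S : {set G}).

Lemma occurs_induced n r o : perm_eq o (iota 0 n) ->
  occurs S (relabel n r o) -> contains_induced G (nat_graph n r).
Proof.
move=> po [s]; have szo : size o = n by rewrite (perm_size po) size_iota.
have mo (x : 'I_n) : (x : nat) \in o.
  by rewrite (perm_mem po) mem_iota /= ltn_ord.
have io (x : 'I_n) : index (x : nat) o < n.
  by rewrite -[n in _ < n]szo index_mem.
rewrite /realizes size_code => -[_ sinj sadj].
exists (fun x : 'I_n => s (index (x : nat) o)); split=> [x y E|x y].
  apply: val_inj; rewrite /= -[LHS](nth_index 0 (mo x)).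
  by rewrite (sinj _ _ (io x) (io y) E) nth_index.
by rewrite sadj // adj_relabel // !nth_index.
Qed.

Lemma occurs_iota n r o : perm_eq o (iota 0 n) ->
  occurs S (relabel n r o) -> occurs S (relabel n r (iota 0 n)).
Proof.
move=> po [s]; have szo : size o = n by rewrite (perm_size po) size_iota.
have mo x : (x \in o) = (x < n) by rewrite (perm_mem po) mem_iota.
have io x : x < n -> index x o < n.
  by rewrite -[n in _ -> _ < n]szo index_mem mo.
rewrite /realizes size_code => -[sS sinj sadj].
exists (fun x => s (index x o)); rewrite /realizes size_code.
split=> [i lin | i j lin ljn E | i j lin ljn]; first exact/sS/io.
  rewrite -(nth_index 0 (_ : i \in o)) ?mo //.
  by rewrite (sinj _ _ (io _ lin) (io _ ljn) E) nth_index // mo.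
by rewrite sadj ?io // !adj_relabel ?io // !nth_index ?mo // !nth_iota.
Qed.

End Occurrence.

(** * The game and the positions Ann can force *)

Section Game.
Variables (G : sgraph) (k : nat).
Implicit Types (A S : {set G}) (c : position G k).

(* From position c, Ann can reach a position satisfying P. *)
Inductive force (P : position G k -> Prop) c : Prop :=
| force_now of P c
| force_move v of c v = None & (exists a, available c v a)
    & (forall a, available c v a -> force P (assign c v a)).

Lemma force_bind (P Q : position G k -> Prop) c :
  force P c -> (forall c', P c' -> force Q c') -> force Q c.
Proof.
move=> Pc PQ; elim: Pc => {c} c; first exact: PQ.
by move=> v cv ex _ IH; apply: force_move cv ex IH.
Qed.

Definition colours A c :=
  (forall v, (c v != None) = (v \in A)) /\
  (forall v a, c v = Some a -> available c v a).

Lemma colours0 : colours set0 (start G k).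
Proof.
by split=> [v | v a]; rewrite ffunE // inE.
Qed.

Lemma colours_assign A c v a : colours A c -> v \notin A ->
  available c v a -> colours (v |: A) (assign c v a).
Proof.
move=> [cA cprop] vA av; split=> [w | w b].
  by rewrite ffunE in_setU1 -cA; case: (w == v).
rewrite ffunE; case: eqVneq => [-> [<-] u vu | wv cw u wu].
  rewrite ffunE; case: eqP => [E|_]; last exact: av.
  by rewrite E edge_irrefl in vu.
rewrite ffunE; case: eqP => [E [ab]|_]; last exact: cprop wu.
by apply: (av w); rewrite ?ab // edge_sym -E.
Qed.

Lemma force_last A c x : colours A c -> x \notin A ->
  (exists a, available c x a) ->
  force (fun c' => colours (x |: A) c' /\ {in A, c' =1 c}) c.
Proof.
move=> cA xA ex; apply: (force_move (v := x)) => //.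
  by apply/eqP; rewrite -[_ == _]negbK cA.1.
move=> a av; apply: force_now; split; first exact: colours_assign.
by move=> v vA; rewrite ffunE; case: eqP => // E; rewrite -E vA in xA.
Qed.

(** The bound counts colours rather than neighbours, so that it also applies when two neighbours
    share a colour. *)
Lemma colours_available A c x : colours A c ->
  #|c @: nbrs A x| < k -> exists a, available c x a.
Proof.
move=> [cA cprop] ltk.
have /subsetPn[_ /imsetP[a _ ->] ca] :
    ~~ ([set Some a | a : 'I_k] \subset c @: nbrs A x).
  apply: contraTN ltk => /subset_leq_card.
  have injS : injective (@Some 'I_k) by move=> ? ? [].
  by rewrite (card_imset _ injS) card_ord -leqNgt.
exists a => w xw cw; case/negP: ca; apply/imsetP; exists w => //.
by rewrite inE xw -cA cw.
Qed.

(** A vertex that sees all [k] colours stays uncoloured and keeps seeing them: Ann's next vertex has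
    an available colour, so it is a different one. This contradicts the final position, where every
    vertex is coloured. *)
Lemma force_not_ben_wins c : force (colours setT) c -> ~ ben_wins c.
Proof.
elim=> {c} c => [[cT _] | v cv [a av] _ IH] [w [cw full]].
  by have := cT w; rewrite cw inE.
have [u [wu cu]] := full a.
have [E|/eqP vw] := w =P v; first by apply: (av u) => //; rewrite -E.
apply: (IH _ av); exists w; rewrite ffunE (negbTE vw); split=> // b.
have [t [wt ct]] := full b; exists t; split=> //.
by rewrite ffunE; case: eqP => // E; rewrite E cv in ct.
Qed.

Lemma force_indicated_colorable :
  force (colours setT) (start G k) -> indicated_colorable G k.
Proof.
move=> w0.
pose good c o := force (colours setT) c -> ~ complete c ->
  exists v, [/\ o = Some v, c v = None &
    forall a, available c v a -> force (colours setT) (assign c v a)].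
(* There are finitely many positions, so a next vertex can be chosen for all of them at once. *)
have /fin_all_exists[s sP] c : exists o, good c o.
  have [[cT|v cv ex next]|nf] := classic (force (colours setT) c).
  - exists None => _ []; move=> v; apply/eqP.
    by have := cT.1 v; rewrite inE.
  - by exists (Some v) => _ _; exists v.
  by exists None.
exists s => c rc; have fc : force (colours setT) c.
  elim: rc => {c} // c v a _ fc sc cv av.
  have [|u [su cu next]] := sP c fc; first by move/(_ v).
  by move: su; rewrite sc => -[E]; rewrite -E in next; apply: next.
split; first exact: force_not_ben_wins.
by move=> /(sP c fc)[v [-> cv _]]; exists v.
Qed.

(** * Colouring a component of maximum degree at most [k] *)

Section Component.
Variables (S : {set G}) (M : seq bitseq) (s : nat -> G).
Hypothesis Ms : realizes S M s.
Hypothesis closed : forall i z, i < size M -> z \in S -> edge (s i) z ->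
  exists2 j, j < size M & z = s j.
Hypothesis deg : all (fun i => count (adj M i) (iota 0 (size M)) <= k)
  (iota 0 (size M)).

Local Notation n := (size M).

(* S minus the vertices of the component M that are not in l. *)
Definition without (l : seq nat) : {set G} :=
  S :\: [set x in [seq s i | i <- [seq i <- iota 0 n | i \notin l]]].

Lemma mem_without l i : i < n -> (s i \in without l) = (i \in l).
Proof.
case: Ms => sS sinj _ lin; rewrite !inE sS // andbT.
apply/idP/idP; last first.
  move=> il; apply/mapP => -[j]; rewrite mem_filter mem_iota /= => /andP[jl jn].
  by move/sinj=> E; rewrite -E ?il // in jl.
apply: contraNT => il; apply/mapP; exists i => //.
by rewrite mem_filter il mem_iota.
Qed.

Lemma without_cons l i : i < n -> without (i :: l) = s i |: without l.
Proof.
case: Ms => sS sinj _ lin; apply/setP=> x; rewrite in_setU1.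
have [->|xi] := eqVneq x (s i); first by rewrite mem_without // mem_head.
rewrite !in_setD; congr (~~ _ && _); rewrite !inE.
apply/mapP/mapP=> -[j]; rewrite mem_filter => /andP[jl jn] E; exists j => //.
  by move: jl; rewrite mem_filter jn inE negb_or => /andP[_ ->].
rewrite mem_filter jn inE negb_or jl !andbT.
by apply: contraNneq xi => <-; rewrite E.
Qed.

Lemma nbrs_le i : i < n -> #|nbrs S (s i)| <= k.
Proof.
case: (Ms) => sS sinj sadj lin.
have /allP/(_ i) := deg; rewrite mem_iota => /(_ lin).
apply: leq_trans; rewrite -size_filter.
rewrite -(size_map s); apply: leq_trans (card_size _).
apply/subset_leq_card/subsetP=> z; rewrite inE => /andP[zS iz].
have [j jn E] := closed lin zS iz.
by rewrite E map_f // mem_filter mem_iota -sadj // -E iz.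
Qed.

(* Every vertex of p still has an uncoloured neighbour when it is played, the
   vertices of l being coloured beforehand. *)
Fixpoint playable (p l : seq nat) :=
  if p is i :: p' then
    [&& i < n, i \notin l,
        has (fun j => adj M i j && (j \notin i :: l)) (iota 0 n)
      & playable p' (i :: l)]
  else true.

(** An uncoloured neighbour leaves at most k - 1 coloured ones, so a colour is available. The second
    conclusion lets equal colours survive the run. *)
Lemma force_run p l c : colours (without l) c -> playable p l ->
  force (fun c' => colours (without (catrev p l)) c' /\
                   {in without l, c' =1 c}) c.
Proof.
case: (Ms) => sS sinj sadj.
elim: p l c => [|i p IHp] l c cl /=; first by move=> _; apply: force_now.
case/and4P=> lin il /hasP[j]; rewrite mem_iota /= => jn /andP[ij].
rewrite inE negb_or => /andP[ji jl] pp.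
have av : exists a, available c (s i) a.
  apply: colours_available cl _.
  apply: leq_ltn_trans (leq_imset_card _ _) _.
  apply: leq_trans (nbrs_le lin); apply/proper_card/properP; split.
    by apply/subsetP=> z; rewrite !inE => /andP[/andP[_ ->] ->].
  exists (s j); first by rewrite inE sS // sadj.
  by rewrite inE mem_without // (negbTE jl).
apply: (force_bind (force_last cl _ av)); first by rewrite mem_without.
move=> c1 [c1l c1c]; rewrite -without_cons // in c1l.
apply: (force_bind (IHp _ _ c1l pp)) => c2 [c2l c2c]; apply: force_now.
split=> // v vl; rewrite c2c ?c1c // without_cons //.
by rewrite in_setU1 vl orbT.
Qed.

(* The last vertex [z] can always be coloured: it has at most [k] neighbours
   and two of them share a colour. *)
Lemma force_finish p l c z u v : colours (without l) c -> playable p l ->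
    z < n -> z \notin catrev p l -> {subset iota 0 n <= z :: catrev p l} ->
    u \in l -> v \in l -> u < n -> v < n -> u != v ->
    adj M z u -> adj M z v -> c (s u) = c (s v) ->
  force (colours S) c.
Proof.
case: (Ms) => sS sinj sadj.
move=> cl pp zn zl cov ul vl un vn uv zu zv cuv.
apply: (force_bind (force_run cl pp)) => c' [c'l c'c].
have ES : S = s z |: without (catrev p l).
  rewrite -without_cons //; apply/setP=> x; rewrite !inE.
  have -> : [seq i <- iota 0 n | i \notin z :: catrev p l] = [::].
    apply/eqP; rewrite -[_ == _]negbK -has_filter -all_predC.
    by apply/allP=> i /cov /= ->.
  by rewrite in_nil.
have lsub i : i \in l -> i \in catrev p l.
  by rewrite catrevE mem_cat orbC => ->.
have av : exists a, available c' (s z) a.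
  apply: colours_available c'l _.
  set N := nbrs _ _.
  have uN : s u \in N by rewrite inE mem_without // lsub // sadj.
  have vN : s v \in N :\ s u.
    rewrite in_setD1 inE mem_without // lsub // sadj // zv !andbT.
    by apply: contraNneq uv => /sinj->.
  have -> : c' @: N = c' @: (N :\ s u).
    apply/eqP; rewrite eqEsubset; apply/andP; split; last first.
      exact/imsetS/subD1set.
    apply/subsetP=> _ /imsetP[x xN ->]; apply/imsetP.
    have [->|xu] := eqVneq x (s u); last by exists x; rewrite // in_setD1 xu.
    by exists (s v); rewrite ?c'c ?mem_without.
  apply: leq_ltn_trans (leq_imset_card _ _) _.
  have := cardsD1 (s u) N; rewrite uN add1n => <-.
  apply: leq_trans (nbrs_le zn); apply/subset_leq_card/subsetP=> x.
  by rewrite !inE => /andP[/andP[_ ->] ->].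
apply: (force_bind (force_last c'l _ av)); first by rewrite mem_without.
by move=> c2 [c2l _]; apply: force_now; rewrite ES.
Qed.

Definition rest (l : seq nat) := [seq i <- iota 0 n | i \notin l].

(** Vertices u and v that share a colour are nonadjacent; z is their common neighbour, kept for the
    last move while the [rest] is played. *)
Definition finishable l :=
  all (fun u => all (fun v => [|| u == v, adj M u v |
    has (fun z => [&& z \notin l, adj M z u, adj M z v
                    & playable (rest (z :: l)) l]) (iota 0 n)]) l) l.

Lemma force_component l c : colours (without [::]) c ->
    playable (rev l) [::] -> uniq l -> k < size l ->
    {subset l <= iota 0 n} -> finishable l ->
  force (colours S) c.
Proof.
case: (Ms) => sS sinj sadj.
move=> c0 pl ul kl ln fin.
have {}ln i : i \in l -> i < n by move/ln; rewrite mem_iota.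
apply: (force_bind (force_run c0 pl)) => {c0}c [cl _].
rewrite catrevE cats0 revK in cl.
(* Pigeonhole: more than [k] vertices are coloured with [k] colours. *)
have /(uniqPn None)[i [j [ij]]] : ~~ uniq [seq c (s i) | i <- l].
  apply: contraTN kl => uc; rewrite -leqNgt -(card_ord k) -cardsT.
  have injS : injective (@Some 'I_k) by move=> ? ? [].
  rewrite -(card_imset _ injS) -(size_map (c \o s) l).
  rewrite -(card_uniqP uc); apply/subset_leq_card/subsetP=> _ /mapP[i il ->].
  have : c (s i) != None by rewrite cl.1 mem_without ?ln.
  by rewrite /=; case: (c (s i)) => // a _; apply: imset_f; rewrite inE.
rewrite size_map => jl; have il := ltn_trans ij jl.
rewrite !(nth_map 0) //; set u := nth 0 l i; set v := nth 0 l j => cuv.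
have ul' : u \in l by apply: mem_nth.
have vl : v \in l by apply: mem_nth.
have uv : u != v by rewrite nth_uniq // ltn_eqF.
have nuv : ~~ adj M u v.
  rewrite -sadj ?ln //; apply/negP=> e.
  have := cl.1 (s u); rewrite mem_without ?ln // ul'.
  by case E: (c (s u)) => [a|] // _; apply: (cl.2 _ _ E _ e); rewrite -cuv.
move/allP: fin => /(_ _ ul')/allP/(_ _ vl).
rewrite (negbTE uv) (negbTE nuv) => /hasP[z].
rewrite mem_iota /= => zn /and4P[zl zu zv pr].
apply: (force_finish cl pr zn _ _ ul' vl _ _ uv zu zv cuv); rewrite ?ln //.
  by rewrite catrevE mem_cat mem_rev mem_filter mem_head.
move=> w; rewrite mem_iota /= => wn.
rewrite inE catrevE mem_cat mem_rev mem_filter mem_iota wn andbT inE negb_or.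
by case: eqP => //=; case: (w \in l).
Qed.

End Component.
End Game.

(** * The concrete patterns and their computations *)

Definition wheel_rel : rel nat :=
  fun i j => (i < 5) && ((j == i.+1 %% 5) || (j == 5)).
Definition prism_rel : rel nat :=
  fun i j => (j == i + 3) || (i %/ 3 == j %/ 3).
(* The square of C_7 is isomorphic to the complement of C_7. *)
Definition square_c7_rel : rel nat :=
  fun i j => (j == i.+1 %% 7) || (j == i.+2 %% 7).

Definition wheel := relabel 6 wheel_rel (iota 0 6).
Definition prism := relabel 6 prism_rel (iota 0 6).
Definition square_c7 := relabel 7 square_c7_rel (iota 0 7).

(* [embeds_last] sends the vertex 0 of a pattern to the newest vertex, so each
   pattern is listed once for every orbit of vertices, as the choice of the
   vertex relabelled 0. *)
Definition forbidden :=
  views 5 (fun i j => j == i.+1)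
    [:: [:: 0; 1; 2; 3; 4]; [:: 1; 0; 2; 3; 4]; [:: 2; 1; 3; 0; 4]] ++
  views 4 (fun _ _ => true) [:: iota 0 4] ++
  views 5 (fun i j =>
      (i, j) \in [:: (0, 1); (0, 2); (1, 2); (1, 3); (2, 3); (3, 4)])
    [:: [:: 0; 1; 2; 3; 4]; [:: 1; 2; 0; 3; 4]; [:: 3; 1; 2; 0; 4];
        [:: 4; 3; 1; 2; 0]] ++
  views 5 (fun i j => (i, j) \in [:: (0, 1); (0, 2); (1, 2); (0, 3); (1, 4)])
    [:: [:: 0; 1; 2; 3; 4]; [:: 2; 0; 1; 3; 4]; [:: 3; 0; 1; 2; 4]].

Definition wheels :=
  views 6 wheel_rel [:: [:: 0; 5; 1; 2; 3; 4]; [:: 5; 0; 1; 2; 3; 4]].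

Lemma refute_wheel : refute forbidden [::] 4 3 wheel.
Proof. by vm_cast_no_check (erefl true). Qed.

Lemma isolates_prism : isolates forbidden wheels 3 3 prism.
Proof. by vm_cast_no_check (erefl true). Qed.

Lemma isolates_square_c7 : isolates forbidden wheels 3 3 square_c7.
Proof. by vm_cast_no_check (erefl true). Qed.

(** The start is a single vertex, with an empty row. The prism and C_7^2 are vertex-transitive, so
    one labelling of each suffices. *)
Lemma refute_start :
  refute forbidden (wheels ++ [:: prism; square_c7]) 3 7 [:: [::]].
Proof. by vm_cast_no_check (erefl true). Qed.

(** * The induction on the vertex set *)

Section Main.
Variable G : sgraph.
Hypothesis hfree : free [:: path_graph 5; complete_graph 4; kite; bull] G.

Lemma forbidden_free (S : {set G}) H : H \in forbidden -> ~ occurs S H.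
Proof.
have noocc n r os :
    List.In (nat_graph n r) [:: path_graph 5; complete_graph 4; kite; bull] ->
    all (perm_eq^~ (iota 0 n)) os ->
    forall H, H \in views n r os -> ~ occurs S H.
  move=> inF /allP pos _ /mapP[o /pos po ->] occ.
  by apply: (hfree inF); apply: occurs_induced po occ.
by rewrite !mem_cat => /or4P[]; apply: noocc => //=; auto 6.
Qed.

Lemma wheels_free (S : {set G}) H :
  ~ occurs S wheel -> H \in wheels -> ~ occurs S H.
Proof.
move=> noW /mapP[o oin ->] occ; apply: noW; apply: occurs_iota occ.
by move: oin; rewrite !inE => /orP[] /eqP->.
Qed.

Variables (k : nat) (f : G -> 'I_k).
Hypothesis fP : forall x y, edge x y -> f x != f y.

(** Both x and t form a triangle with the edge yz, which leaves them only the third colour. *)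
Lemma diamond_colour x y z t : k <= 3 -> edge y z -> edge x y -> edge x z ->
  edge t y -> edge t z -> f x = f t.
Proof.
move=> k3 /fP yz /fP xy /fP xz /fP ty /fP tz; apply/eqP; apply: contraTT k3.
move=> xt; have u : uniq [:: f x; f y; f z; f t].
  by rewrite /= !inE !negb_or xy xz xt yz eq_sym ty eq_sym tz.
rewrite -ltnNge; move/card_uniqP: u => /= <-.
by rewrite -[X in _ <= X]card_ord max_card.
Qed.

Lemma realized_diamond (S : {set G}) M s i j h l : k <= 3 -> realizes S M s ->
    all (gtn (size M)) [:: i; j; h; l] ->
    [&& adj M j h, adj M i j, adj M i h, adj M l j & adj M l h] ->
  f (s i) = f (s l).
Proof.
move=> k3 [_ _ sadj] /and5P[iM jM hM lM _] /and5P[*].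
by apply: (@diamond_colour _ (s j) (s h)); rewrite ?sadj.
Qed.

Lemma wheel_chromatic (S : {set G}) : occurs S wheel -> 3 < k.
Proof.
case=> s Ms; rewrite ltnNge; apply/negP=> k3.
have D i j h l := @realized_diamond S wheel s i j h l k3 Ms.
have E : edge (s 0) (s 4) by case: Ms => _ _ ->.
(* The triangles at the hub 5 give the rim vertices 0, 2 and 4 one colour, but 0 and 4 are
   adjacent. *)
by have := fP E; rewrite (D 0 5 1 2) // (D 2 5 3 4) // eqxx.
Qed.

Lemma square_c7_chromatic (S : {set G}) : occurs S square_c7 -> 3 < k.
Proof.
case=> s Ms; rewrite ltnNge; apply/negP=> k3.
have D i j h l := @realized_diamond S square_c7 s i j h l k3 Ms.
have E : edge (s 0) (s 6) by case: Ms => _ _ ->.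
(* Consecutive diamonds give 0, 3 and 6 one colour, but 0 and 6 are adjacent. *)
by have := fP E; rewrite (D 0 1 2 3) // (D 3 4 5 6) // eqxx.
Qed.

Hypothesis k3 : 2 < k.

Lemma force_all (S : {set G}) : force (colours S) (start G k).
Proof.
have [n] := ubnP #|S|; elim: n S => // n IHn S; rewrite ltnS => Sn.
have IH (A : {set G}) : A \proper S -> force (colours A) (start G k).
  by move=> /proper_card AS; apply/IHn/(leq_trans AS).
have del x : x \in S ->
    (forall c : position G k, colours (S :\ x) c ->
       exists a, available c x a) ->
    force (colours S) (start G k).
  move=> xS av; apply: (force_bind (IH _ (properD1 xS))) => c cS.
  apply: (force_bind (force_last cS _ (av c cS))); first by rewrite !inE eqxx.
  by move=> c' [c'S _]; apply: force_now; rewrite -(setD1K xS).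
have [/exists_inP[x xS degx]|/exists_inPn deg] :=
  boolP [exists x in S, #|nbrs S x| < k].
  apply: (del x xS) => c cS; apply: colours_available cS _.
  apply: leq_ltn_trans (leq_imset_card _ _) _; apply: leq_ltn_trans degx.
  by apply/subset_leq_card/subsetP=> y; rewrite !inE => /andP[/andP[_ ->]].
have [/exists_inP[x xS /exists_inP[y yS /andP[xy sub]]]|nd] :=
  boolP [exists x in S, exists y in S, (x != y) && (nbrs S x \subset nbrs S y)].
  apply: (del x xS) => c [cS cprop].
  have := cS y; rewrite !inE (eq_sym y) xy yS.
  case E: (c y) => [a|] // _; exists a => w xw cw.
  have wS : w \in S by have := cS w; rewrite cw !inE => /esym/andP[].
  have /(subsetP sub) : w \in nbrs S x by rewrite inE wS.
  by rewrite inE => /andP[_ yw]; apply: (cprop _ _ E _ yw).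
have {}deg d : d <= k -> forall x, x \in S -> d <= #|nbrs S x|.
  by move=> dk x /deg; rewrite -leqNgt; apply: leq_trans.
have {}nd x y : x \in S -> y \in S -> x != y -> ~~ (nbrs S x \subset nbrs S y).
  move=> xS yS xy; apply: contra nd => sub.
  by apply/exists_inP; exists x => //; apply/exists_inP; exists y; rewrite ?xy.
have noF := @forbidden_free S.
have [W|noW] := classic (occurs S wheel).
  have k4 := wheel_chromatic W; case: W => s Ms.
  have noT H : H \in [::] -> ~ occurs S H by [].
  by have := refute_sound noF noT (deg 4 k4) nd 3 Ms; rewrite refute_wheel.
have noWs H : H \in wheels -> ~ occurs S H by exact: wheels_free.
have component M d l : occurs S M -> isolates forbidden wheels 3 3 M ->
    all (fun i => count (adj M i) (iota 0 (size M)) <= d) (iota 0 (size M)) ->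
    [&& playable M (rev l) [::], uniq l, all (mem (iota 0 (size M))) l,
        finishable M l & 0 < size M] ->
    d <= k -> size l = d.+1 -> force (colours S) (start G k).
  case=> s Ms iso degM /and5P[pl ul /allP ln fin M0] dk szl.
  have closed i z : i < size M -> z \in S -> edge (s i) z ->
      exists2 j, j < size M & z = s j.
    exact: (isolates_sound noF noWs (deg 3 k3) nd Ms iso).
  have s0S : s 0 \in S by case: Ms => sS _ _; apply: sS.
  (* The vertex [s 0] has at least [k] neighbours in S; they all lie in [M], so there are at most
     [d]. *)
  have /eqP dE : d == k.
    rewrite eqn_leq dk; apply: leq_trans (deg k (leqnn k) _ s0S) _.
    exact: nbrs_le Ms closed degM _ M0.
  (* The induction hypothesis colours S minus the whole component first. *)
  have /IH : without S M s [::] \proper S.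
    rewrite properE subsetDl; apply/subsetPn; exists (s 0) => //.
    by rewrite (mem_without Ms).
  move/force_bind; apply=> c c0; rewrite dE in degM szl.
  by apply: (force_component Ms closed degM c0 pl ul _ ln fin); rewrite szl.
have [P|noP] := classic (occurs S prism).
  (* Among 0, 1, 2, 3 the nonadjacent pairs are {1, 3} and {2, 3}, with common neighbours 4 and
     5. *)
  exact: (component _ 3 [:: 3; 2; 1; 0] P isolates_prism).
have [C|noC] := classic (occurs S square_c7).
  (* Among 0, ..., 4 the nonadjacent pairs are {0, 3}, {0, 4} and {1, 4}; 5 is a common neighbour
     for the first two, 6 for the last. *)
  apply: (component _ 4 [:: 4; 3; 2; 1; 0] C isolates_square_c7) => //.
  exact: square_c7_chromatic C.
have [->|[x xS]] := set_0Vmem S; first exact/force_now/colours0.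
have noT H : H \in wheels ++ [:: prism; square_c7] -> ~ occurs S H.
  by rewrite mem_cat => /orP[|]; [apply: noWs | rewrite !inE => /orP[] /eqP->].
have Ms : realizes S [:: [::]] (fun=> x).
  by split=> // [[|?] [|?] | [|?] [|?]] //= _ _; rewrite edge_irrefl.
by have := refute_sound noF noT (deg 3 k3) nd 7 Ms; rewrite refute_start.
Qed.

End Main.

Theorem theorem2p8 (G : sgraph)
  (hfree : free [:: path_graph 5; complete_graph 4; kite; bull] G)
  (hC5 : contains_induced G (cycle_graph 5)) :
  forall k : nat, chi G <= k -> indicated_colorable G k.
Proof.
move=> k; rewrite /chi; case: ex_minnP => m /existsP[g gP] _ mk.
pose f x := widen_ord mk (g x).
have fP x y : edge x y -> f x != f y.
  by move=> xy; have /forallP/(_ x)/forallP/(_ y)/implyP/(_ xy) := gP.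
(* The odd cycle C_5 needs three colours: with two, 0, 2 and 4 would agree although 4 and 0 are
   adjacent. *)
have k3 : 2 < k.
  case: hC5 => h [_ he]; rewrite ltnNge; apply/negP=> k2.
  pose v i := f (h (inord i)).
  have e i j : i < 5 -> j < 5 -> i != j -> j == i.+1 %% 5 -> v i != v j.
    move=> i5 j5 ij ji; apply: fP.
    by rewrite he /edge /= /nat_edge -(inj_eq val_inj) /= !inordK // ij ji.
  have D i j l : v i != v j -> v j != v l -> v i = v l.
    move=> ij jl; apply/eqP; apply: contraTT k2 => il.
    have u : uniq [:: v i; v j; v l] by rewrite /= !inE negb_or ij jl il.
    rewrite -ltnNge; move/card_uniqP: u => /= <-.
    by rewrite -[X in _ <= X]card_ord max_card.
  have v02 : v 0 = v 2 by apply: (D 0 1 2); apply: e.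
  have v24 : v 2 = v 4 by apply: (D 2 3 4); apply: e.
  by have := e 4 0 isT isT isT isT; rewrite v02 v24 eqxx.
apply: force_indicated_colorable.
exact: (force_all hfree fP k3).
Qed.
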